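(* Let $H_1,H_2$ be non-trivial countable discrete groups with $H_1\not\cong \mathbb Z/2\mathbb Z$, and let $G = H_1 \ast H_2$ be their free product. Then there exists a $1$-cocycle $c\colon G\to\ell^2 G$ which is neither proper nor bounded. In particular, this is the case for $PSL_2(\mathbb Z) = \mathbb Z/2\mathbb Z \ast \mathbb Z/3\mathbb Z$.
   Context: $\ell^2 G$ is a $G$-module via the left regular representation. A $1$-cocycle $c\colon G\to\ell^2 G$ is a map with $c(gh)=g\cdot c(h)+c(g)$ for all $g,h\in G$. It is bounded if $\sup_{g\in G}\|c(g)\|_2<\infty$, and proper if for every $C>0$ the set $\{g\in G: \|c(g)\|_2\le C\}$ is finite. *)

(* Defs.v *)
From HB Require Import structures.
From mathcomp Require Import all_boot all_order all_algebra all_fingroup.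
From mathcomp Require Import generic_quotient complex.
From mathcomp Require Import boolp classical_sets functions cardinality.
From mathcomp Require Import fsbigop reals ereal esum ring.

Set Implicit Arguments.
Unset Strict Implicit.
Unset Printing Implicit Defensive.

Import Order.TTheory GRing.Theory Num.Theory.

Local Open Scope group_scope.

(* Possibly infinite discrete groups are the [groupType]s of monoid.v; the
   cyclic group Z/n is the additive [groupType] structure on 'Z_n (n > 1). *)
Definition isomorphic (G H : groupType) : Prop :=
  exists f : {multiplicative G -> H}, bijective f.

Definition nontrivial (G : groupType) : Prop := exists x : G, x <> 1.

(* The free product, realised on reduced words: sequences of non-identity
   elements of the two factors, in which neighbours lie in different factors.
   The universal property is [free_product_universal] below. *)
Section Words.
Variables H1 H2 : groupType.
Local Notation letter := (H1 + H2)%type.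
Implicit Types (a b c : letter) (u v w : seq letter).

Definition letter_is1 a :=
  match a with inl x => x == 1 | inr y => y == 1 end.

Definition letter_inv a : letter :=
  match a with inl x => inl x^-1 | inr y => inr y^-1 end.

(* None when the letters belong to different factors *)
Definition letter_mul a b : option letter :=
  match a, b with
  | inl x, inl y => Some (inl (x * y))
  | inr x, inr y => Some (inr (x * y))
  | _, _ => None
  end.

Definition alternate a b := letter_mul a b == None.

Definition reduced w := all (predC letter_is1) w && sorted alternate w.

(* the reduced form of a :: w, for w reduced *)
Definition push a w : seq letter :=
  if letter_is1 a then w else
  if w is b :: w' then
    if letter_mul a b is Some c then
      if letter_is1 c then w' else c :: w'
    else a :: w
  else [:: a].

Lemma reduced_behead a w : reduced (a :: w) -> reduced w.
Proof.
rewrite /reduced /= => /andP[/andP[_ ->]] /=.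
exact: path_sorted.
Qed.

Lemma reduced_push a w : reduced w -> reduced (push a w).
Proof.
rewrite /push; case: ifPn => // a1; case: w => [|b w] rw.
  by rewrite /reduced /= a1.
have rw' := reduced_behead rw.
case E: (letter_mul a b) => [c|]; last first.
  by move: rw; rewrite /reduced /= a1 /alternate E eqxx.
case: ifPn => // c1; move: rw; rewrite /reduced /= c1 => /andP[/andP[_ ->]] /=.
case: w {rw'} => //= d w /andP[bd ->]; rewrite andbT.
by case: a b c d E bd {a1 c1} => x [] y [] z [] t.
Qed.

Lemma push_reduced a w : reduced (a :: w) -> push a w = a :: w.
Proof.
rewrite /reduced /push /= => /andP[/andP[/negPf -> _]].
by case: w => //= b w /andP[/eqP ->].
Qed.

Lemma push1 a w : letter_is1 a -> push a w = w.
Proof. by rewrite /push => ->. Qed.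

Lemma letter_mulA a b c ab bc :
  letter_mul a b = Some ab -> letter_mul b c = Some bc ->
  letter_mul a bc = letter_mul ab c.
Proof.
by case: a b c => x [] y [] z //= [<-] [<-]; rewrite /= mulgA.
Qed.

Let head_free a w := if w is b :: _ then alternate a b else true.

Let push_push_free a b c w : letter_mul a b = Some c -> head_free b w ->
  push a (push b w) = push c w.
Proof.
case: a b c => x [] y [] z // [<-] {z}; case: w => [|d w]; rewrite /push /=;
  try (case: d => t // _);
  have [->|x1] := eqVneq x 1; rewrite ?mul1g //;
  have [->|y1] := eqVneq y 1; rewrite ?mulg1 ?(negPf x1) ?eqxx //;
  try (by case: (w) => // -[]); by case: eqP.
Qed.

Lemma push_push a b c w : reduced w -> letter_mul a b = Some c ->
  push a (push b w) = push c w.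
Proof.
move=> rw abc.
have [d [w0 [bd [bde [fd ->]]]]] : exists d w0 bd,
    letter_mul b d = Some bd /\ head_free d w0 /\ w = push d w0.
  pose one : letter := if b is inl _ then inl 1 else inr 1.
  case: w rw => [|e w] rw.
    exists one, [::]; rewrite /one.
    by case: (b) => x; [exists (inl (x * 1))|exists (inr (x * 1))];
      rewrite push1 //= eqxx.
  case E: (letter_mul b e) => [be|].
    exists e, w, be; rewrite push_reduced //; do !split=> //.
    by move: rw => /andP[_]; case: (w) => //= t u /andP[].
  exists one, (e :: w); rewrite /one; move: E; rewrite /alternate.
  by case: (b) (e) => x [] y //= _; [exists (inl (x * 1))|exists (inr (x * 1))];
      rewrite push1 /= ?eqxx //.
rewrite (push_push_free bde fd).
case E: (letter_mul c d) => [cd|]; last first.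
  by case: (a) (b) (c) (d) abc bde E => x [] y [] z [].
rewrite (push_push_free E fd); apply: push_push_free.
  by rewrite (letter_mulA abc bde).
case: w0 fd => //= e w0; rewrite /alternate.
by case: (b) (d) (e) bde => x [] y [] z //= [<-].
Qed.

Definition word_mul u v := foldr push v u.

Lemma reduced_mul u v : reduced v -> reduced (word_mul u v).
Proof. by move=> rv; elim: u => //= a u; apply: reduced_push. Qed.

Lemma push_mul a u v : reduced u -> reduced v ->
  push a (word_mul u v) = word_mul (push a u) v.
Proof.
move=> ru rv; have [a1|a1] := boolP (letter_is1 a); first by rewrite !push1.
case: u ru => [|b u] ru /=; first by rewrite {2}/push (negPf a1).
rewrite [push a (b :: u)]/push (negPf a1).
case E: (letter_mul a b) => [c|] //.
rewrite (push_push (reduced_mul u rv) E).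
by case: ifPn => // /push1 ->.
Qed.

Lemma word_mulA u v w : reduced v -> reduced w ->
  word_mul u (word_mul v w) = word_mul (word_mul u v) w.
Proof.
move=> rv rw; elim: u => //= a u ->.
by rewrite push_mul // reduced_mul.
Qed.

Lemma word_mulw1 u : reduced u -> word_mul u [::] = u.
Proof.
elim: u => //= a u IH ru; rewrite IH ?push_reduced //.
exact: reduced_behead ru.
Qed.

Definition word_inv w := rev (map letter_inv w).

Lemma word_invK : involutive word_inv.
Proof.
move=> w; rewrite /word_inv map_rev revK -map_comp map_id_in // => a _.
by case: a => x /=; rewrite invgK.
Qed.

Lemma reduced_inv w : reduced w -> reduced (word_inv w).
Proof.
rewrite /reduced /word_inv all_rev rev_sorted sorted_map all_map.
move=> /andP[aw sw]; apply/andP; split.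
  by apply: sub_all aw => -[] x /=; rewrite invg_eq1.
by apply: sub_sorted sw => -[] x [].
Qed.

Lemma word_mulVw w : reduced w -> word_mul (word_inv w) w = [::].
Proof.
rewrite /word_mul /word_inv; elim: w => //= a w IH ra.
have rw := reduced_behead ra; rewrite rev_cons foldr_rcons.
rewrite -(push_reduced ra).
have [c ac c1] : exists2 c,
    letter_mul (letter_inv a) a = Some c & letter_is1 c.
  case: (a) => x; [exists (inl 1)|exists (inr 1)] => //=;
    by rewrite mulVg.
by rewrite (push_push rw ac) push1 // IH.
Qed.

Record free_product := FreeProduct {
  word_of : seq letter;
  _ : reduced word_of
}.

HB.instance Definition _ := [isSub for word_of].
HB.instance Definition _ := [Choice of free_product by <:].

Implicit Types p q r : free_product.

Definition fp_one := @FreeProduct [::] isT.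
Definition fp_mul p q := FreeProduct (reduced_mul (val p) (valP q)).
Definition fp_inv p := FreeProduct (reduced_inv (valP p)).

Lemma fp_mulA : associative fp_mul.
Proof. by move=> p q r; apply/val_inj; rewrite /= word_mulA ?(valP q) ?(valP r). Qed.

Lemma fp_mul1 : left_id fp_one fp_mul.
Proof. by move=> p; apply/val_inj. Qed.

Lemma fp_mulr1 : right_id fp_one fp_mul.
Proof. by move=> p; apply/val_inj; rewrite /= word_mulw1 ?(valP p). Qed.

Lemma fp_mulV : left_inverse fp_one fp_inv fp_mul.
Proof. by move=> p; apply/val_inj; rewrite /= word_mulVw ?(valP p). Qed.

Lemma fp_mulrV : right_inverse fp_one fp_inv fp_mul.
Proof.
move=> p; rewrite -[X in fp_mul X _](_ : fp_inv (fp_inv p) = p) ?fp_mulV //.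
by apply/val_inj; rewrite /= word_invK.
Qed.

HB.instance Definition _ :=
  isGroup.Build free_product fp_mulA fp_mul1 fp_mulr1 fp_mulV fp_mulrV.

Definition fp_inl (x : H1) : free_product :=
  FreeProduct (reduced_push (inl x) (isT : reduced [::])).
Definition fp_inr (y : H2) : free_product :=
  FreeProduct (reduced_push (inr y) (isT : reduced [::])).

Lemma fp_inlM : {morph fp_inl : x y / x * y}.
Proof.
move=> x y; apply/val_inj; symmetry.
rewrite -[LHS]/(word_mul (push (inl x) [::]) (push (inl y) [::])).
by rewrite -push_mul ?reduced_push // (push_push (c := inl (x * y))).
Qed.

Lemma fp_inrM : {morph fp_inr : x y / x * y}.
Proof.
move=> x y; apply/val_inj; symmetry.
rewrite -[LHS]/(word_mul (push (inr x) [::]) (push (inr y) [::])).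
by rewrite -push_mul ?reduced_push // (push_push (c := inr (x * y))).
Qed.

HB.instance Definition _ := isMultiplicative.Build _ _ fp_inl fp_inlM.
HB.instance Definition _ := isMultiplicative.Build _ _ fp_inr fp_inrM.

Theorem free_product_universal (K : groupType)
    (f1 : {multiplicative H1 -> K}) (f2 : {multiplicative H2 -> K}) :
  exists f : {multiplicative free_product -> K},
    [/\ forall x, f (fp_inl x) = f1 x, forall y, f (fp_inr y) = f2 y &
        forall f' : {multiplicative free_product -> K},
          (forall x, f' (fp_inl x) = f1 x) ->
          (forall y, f' (fp_inr y) = f2 y) -> f' =1 f].
Proof.
have mor1 (G : groupType) (h : {multiplicative G -> K}) : h 1 = 1.
  by apply: (mulIg (h 1)); rewrite -gmulfM !mul1g.
pose ev (a : letter) := match a with inl x => f1 x | inr y => f2 y end.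
pose evw w := foldr (fun a k => ev a * k) 1 w.
have ev1 a : letter_is1 a -> ev a = 1.
  by case: a => x /eqP ->; apply: mor1.
have evM a b c : letter_mul a b = Some c -> ev c = ev a * ev b.
  by case: a b => x [] y //= [<-] /=; rewrite gmulfM.
have ev_push a w : evw (push a w) = ev a * evw w.
  rewrite /push; case: ifPn => [/ev1 ->|_]; first by rewrite mul1g.
  case: w => //= b w; case E: (letter_mul a b) => [c|] //.
  by rewrite mulgA -(evM _ _ _ E); case: ifPn => // /ev1 ->; rewrite mul1g.
have evwM p q : evw (val (p * q)) = evw (val p) * evw (val q).
  rewrite -[val (p * q)]/(word_mul (val p) (val q)) /word_mul.
  elim: (val p) => [|a w IH] /=; first by rewrite mul1g.
  by rewrite ev_push IH mulgA.
pose evp (p : free_product) : K := evw (word_of p).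
pose evpM := isMultiplicative.Build free_product K evp evwM.
pose f : {multiplicative free_product -> K} := HB.pack evp evpM.
exists f; split.
- by move=> x; rewrite -[LHS]/(evw (push (inl x) [::])) ev_push /= mulg1.
- by move=> y; rewrite -[LHS]/(evw (push (inr y) [::])) ev_push /= mulg1.
move=> f' f'1 f'2 [w rw].
elim: w rw => [|a w IH] rw; first
  by rewrite -[RHS]/(1 : K) -(mor1 _ f'); congr (f' _); apply/val_inj.
have rw' := reduced_behead rw.
rewrite -[RHS]/(ev a * f (FreeProduct rw')) -(IH rw').
pose ia := match a with inl x => fp_inl x | inr y => fp_inr y end.
have -> : ev a = f' ia by rewrite /ia; case: (a) => x; rewrite ?f'1 ?f'2.
rewrite -gmulfM; congr (f' _); apply/val_inj => /=.
rewrite -(push_reduced rw).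
have -> : word_of ia = push a [::] by rewrite /ia; case: (a).
by rewrite -push_mul.
Qed.
End Words.

Section Ell2.
Variables (R : realType) (G : groupType).
Import Normc.
Local Open Scope ring_scope.
Local Open Scope complex_scope.
Local Open Scope classical_set_scope.

(* the sum of the |f g|^2 over all g in G, in [0, +oo] *)
Definition sum_sqr (f : G -> R[i]) : \bar R :=
  (\esum_(g in [set: G]) ((normc (f g) ^+ 2)%:E))%E.

Definition square_summable : {pred G -> R[i]} :=
  [pred f | (sum_sqr f < +oo)%E].

Lemma sum_sqrZ_le (k : R) (f : G -> R[i]) : 0 <= k ->
  (\esum_(g in [set: G]) (k * normc (f g) ^+ 2)%:E <= k%:E * sum_sqr f)%E.
Proof.
move=> k0; apply: ge_ereal_sup => _ [A [finA _] <-].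
under eq_fsbigr do rewrite EFinM.
rewrite -ge0_mule_fsumr; last by move=> g; rewrite lee_fin sqr_ge0.
by apply: lee_wpmul2l; rewrite ?lee_fin //; apply: ereal_sup_ubound; exists A.
Qed.

Lemma normc_sqrD (x y : R[i]) :
  normc (x + y) ^+ 2 <= 2 * normc x ^+ 2 + 2 * normc y ^+ 2.
Proof.
have n0 z : 0 <= normc z :> R by case: z => a b; apply: sqrtr_ge0.
have xy : normc (x + y) ^+ 2 <= (normc x + normc y) ^+ 2.
  by rewrite lerXn2r ?nnegrE ?addr_ge0 // le_normcD.
apply: le_trans xy _; rewrite -subr_ge0.
rewrite (_ : _ - _ = (normc x - normc y) ^+ 2) ?sqr_ge0 //.
by rewrite sqrrB sqrrD !mulr_natl !mulr2n !opprD !addrA; ring.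
Qed.

Lemma square_summable_submod : submod_closed square_summable.
Proof.
split=> [|a u v]; rewrite !inE.
  by rewrite /sum_sqr esum1 ?ltry // => g _; rewrite normc0 expr0n.
move=> uoo voo; pose k := 2 * normc a ^+ 2.
have k0 : 0 <= k by rewrite mulr_ge0 ?sqr_ge0.
have le_auv : (sum_sqr (a *: u + v)%R <= k%:E * sum_sqr u + 2%:E * sum_sqr v)%E.
  apply: le_trans (leeD (sum_sqrZ_le _ k0) (sum_sqrZ_le _ (ler0n _ 2))).
  rewrite -esumD; do ?by move=> *; rewrite lee_fin mulr_ge0 ?sqr_ge0.
  apply: le_esum => g _; rewrite -EFinD lee_fin.
  apply: le_trans (normc_sqrD _ _) _.
  by rewrite normcM exprMn mulrA.
apply: le_lt_trans le_auv _; apply: lte_add_pinfty.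
  by apply: lte_mul_pinfty; rewrite ?lee_fin.
by apply: lte_mul_pinfty; rewrite ?lee_fin.
Qed.

HB.instance Definition _ :=
  GRing.isSubmodClosed.Build R[i] (G -> R[i]) square_summable
    square_summable_submod.

Record ell2 := Ell2 {
  ell2_fun :> G -> R[i];
  _ : ell2_fun \in square_summable
}.

HB.instance Definition _ := [isSub for ell2_fun].
HB.instance Definition _ := [Choice of ell2 by <:].
HB.instance Definition _ := [SubChoice_isSubLmodule of ell2 by <:].

Definition ell2_norm (f : ell2) : R := Num.sqrt (fine (sum_sqr f)).

Lemma square_summable_translate (g : G) (f : ell2) :
  (fun x => f (g^-1 * x)%g) \in square_summable.
Proof.
have := valP f; rewrite !inE /sum_sqr (reindex_esum [set: G] _ (mulg g^-1)) //.
split=> [//|x y _ _ /mulgI //|y _].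
by exists (g * y)%g => //; rewrite mulKg.
Qed.

Definition left_regular (g : G) (f : ell2) : ell2 :=
  Ell2 (square_summable_translate g f).

Lemma left_regular1 : left_regular 1%g =1 id.
Proof.
by move=> f; apply/val_inj/funext => x /=; rewrite invg1 mul1g.
Qed.

Lemma left_regularM (g h : G) (f : ell2) :
  left_regular (g * h)%g f = left_regular g (left_regular h f).
Proof.
by apply/val_inj/funext => x /=; rewrite invgM mulgA.
Qed.

Lemma left_regular_linear (g : G) : linear (left_regular g).
Proof. by move=> a u v; apply/val_inj/funext. Qed.

Definition cocycle (c : G -> ell2) : Prop :=
  forall g h : G, c (g * h)%g = left_regular g (c h) + c g.

Definition bounded_cocycle (c : G -> ell2) : Prop :=
  (ereal_sup [set (ell2_norm (c g))%:E | g in [set: G]] < +oo)%E.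

Definition proper_cocycle (c : G -> ell2) : Prop :=
  forall C : R, 0 < C -> finite_set [set g : G | ell2_norm (c g) <= C].

End Ell2.

Local Open Scope ring_scope.

Record SL2Z := MkSL2Z {
  SL2Z_mx :> 'M[int]_2;
  _ : \det SL2Z_mx == 1
}.

HB.instance Definition _ := [isSub for SL2Z_mx].
HB.instance Definition _ := [Choice of SL2Z by <:].

Section SL2ZTheory.
Implicit Types A B C : SL2Z.

Lemma SL2Z_det A : \det A = 1. Proof. exact/eqP/(valP A). Qed.

Lemma SL2Z_unit A : (A : 'M[int]_2) \in unitmx.
Proof. by rewrite unitmxE SL2Z_det unitr1. Qed.

Lemma SL2Z_one_subproof : \det (1%:M : 'M[int]_2) == 1.
Proof. by rewrite det1. Qed.

Lemma SL2Z_mul_subproof A B : \det (A *m B) == 1.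
Proof. by rewrite det_mulmx !SL2Z_det mulr1. Qed.

Lemma SL2Z_inv_subproof A : \det (invmx A) == 1.
Proof. by rewrite det_inv SL2Z_det invr1. Qed.

Lemma SL2Z_opp_subproof A : \det (- (A : 'M[int]_2)) == 1.
Proof. by rewrite -scaleN1r detZ SL2Z_det mulr1 sqrrN expr1n. Qed.

Definition SL2Z_one := MkSL2Z SL2Z_one_subproof.
Definition SL2Z_mul A B := MkSL2Z (SL2Z_mul_subproof A B).
Definition SL2Z_inv A := MkSL2Z (SL2Z_inv_subproof A).
Definition SL2Z_opp A := MkSL2Z (SL2Z_opp_subproof A).

Lemma SL2Z_mulA : associative SL2Z_mul.
Proof. by move=> A B C; apply/val_inj; rewrite /= mulmxA. Qed.
Lemma SL2Z_mul1 : left_id SL2Z_one SL2Z_mul.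
Proof. by move=> A; apply/val_inj; rewrite /= mul1mx. Qed.
Lemma SL2Z_mulr1 : right_id SL2Z_one SL2Z_mul.
Proof. by move=> A; apply/val_inj; rewrite /= mulmx1. Qed.
Lemma SL2Z_mulV : left_inverse SL2Z_one SL2Z_inv SL2Z_mul.
Proof. by move=> A; apply/val_inj; rewrite /= mulVmx ?SL2Z_unit. Qed.
Lemma SL2Z_mulrV : right_inverse SL2Z_one SL2Z_inv SL2Z_mul.
Proof. by move=> A; apply/val_inj; rewrite /= mulmxV ?SL2Z_unit. Qed.

HB.instance Definition _ :=
  isGroup.Build SL2Z SL2Z_mulA SL2Z_mul1 SL2Z_mulr1 SL2Z_mulV SL2Z_mulrV.

(* A and B have the same image in SL_2(Z) / {1, -1} *)
Definition SL2Z_pm A B := (A == B) || (A == SL2Z_opp B).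

Lemma SL2Z_oppK : involutive SL2Z_opp.
Proof. by move=> A; apply/val_inj; rewrite /= opprK. Qed.

Lemma SL2Z_pm_refl : reflexive SL2Z_pm.
Proof. by move=> A; rewrite /SL2Z_pm eqxx. Qed.

Lemma SL2Z_pm_sym : symmetric SL2Z_pm.
Proof.
move=> A B; rewrite /SL2Z_pm [B == A]eq_sym; congr (_ || _).
by rewrite eq_sym (inv_eq SL2Z_oppK).
Qed.

Lemma SL2Z_pm_trans : transitive SL2Z_pm.
Proof.
move=> B A C /orP[]/eqP-> /orP[]/eqP->; rewrite /SL2Z_pm ?SL2Z_oppK eqxx //;
by rewrite orbT.
Qed.

Canonical SL2Z_pm_equiv :=
  EquivRel SL2Z_pm SL2Z_pm_refl SL2Z_pm_sym SL2Z_pm_trans.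

End SL2ZTheory.

Definition PSL2Z := {eq_quot SL2Z_pm}%qT.
HB.instance Definition _ := Choice.on PSL2Z.
HB.instance Definition _ := EqQuotient.on PSL2Z.

Section PSL2ZTheory.
Local Open Scope quotient_scope.
Implicit Types (A B : SL2Z) (x y z : PSL2Z).

Definition PSL2Z_proj (A : SL2Z) : PSL2Z := \pi_PSL2Z A.

Lemma PSL2Z_projP A B : (PSL2Z_proj A == PSL2Z_proj B) = SL2Z_pm A B.
Proof. exact: eqmodE. Qed.

Lemma PSL2Z_repr x : PSL2Z_proj (repr x) = x.
Proof. exact: reprK. Qed.

Definition PSL2Z_one : PSL2Z := PSL2Z_proj 1%g.
Definition PSL2Z_mul x y : PSL2Z := PSL2Z_proj (repr x * repr y)%g.
Definition PSL2Z_inv x : PSL2Z := PSL2Z_proj (repr x)^-1%g.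

Lemma PSL2Z_repr_proj A : SL2Z_pm (repr (PSL2Z_proj A)) A.
Proof. by rewrite -PSL2Z_projP PSL2Z_repr. Qed.

Lemma PSL2Z_mulE A B :
  PSL2Z_mul (PSL2Z_proj A) (PSL2Z_proj B) = PSL2Z_proj (A * B)%g.
Proof.
apply/eqP; rewrite PSL2Z_projP /SL2Z_pm.
case/orP: (PSL2Z_repr_proj A) => /eqP->; case/orP: (PSL2Z_repr_proj B) => /eqP->;
by rewrite -!val_eqE /= ?mulNmx ?mulmxN ?opprK eqxx ?orbT.
Qed.

Lemma PSL2Z_invE A : PSL2Z_inv (PSL2Z_proj A) = PSL2Z_proj A^-1%g.
Proof.
apply/eqP; rewrite PSL2Z_projP /SL2Z_pm.
case/orP: (PSL2Z_repr_proj A) => /eqP->; rewrite ?eqxx //.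
apply/orP; right; apply/eqP/(@mulgI _ (SL2Z_opp A)); rewrite mulgV.
by apply/val_inj; rewrite /= mulNmx mulmxN opprK mulmxV ?SL2Z_unit.
Qed.

Lemma PSL2Z_mulA : associative PSL2Z_mul.
Proof.
move=> x y z; rewrite -[x]PSL2Z_repr -[y]PSL2Z_repr -[z]PSL2Z_repr.
by rewrite !PSL2Z_mulE mulgA.
Qed.
Lemma PSL2Z_mul1 : left_id PSL2Z_one PSL2Z_mul.
Proof. by move=> x; rewrite -[x]PSL2Z_repr PSL2Z_mulE mul1g. Qed.
Lemma PSL2Z_mulr1 : right_id PSL2Z_one PSL2Z_mul.
Proof. by move=> x; rewrite -[x]PSL2Z_repr PSL2Z_mulE mulg1. Qed.
Lemma PSL2Z_mulV : left_inverse PSL2Z_one PSL2Z_inv PSL2Z_mul.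
Proof. by move=> x; rewrite -[x]PSL2Z_repr PSL2Z_invE PSL2Z_mulE mulVg. Qed.
Lemma PSL2Z_mulrV : right_inverse PSL2Z_one PSL2Z_inv PSL2Z_mul.
Proof. by move=> x; rewrite -[x]PSL2Z_repr PSL2Z_invE PSL2Z_mulE mulgV. Qed.

HB.instance Definition _ :=
  isGroup.Build PSL2Z PSL2Z_mulA PSL2Z_mul1 PSL2Z_mulr1 PSL2Z_mulV PSL2Z_mulrV.

Lemma PSL2Z_projM : {morph PSL2Z_proj : A B / (A * B)%g}.
Proof. by move=> A B; rewrite -PSL2Z_mulE. Qed.

HB.instance Definition _ :=
  isMultiplicative.Build SL2Z PSL2Z PSL2Z_proj PSL2Z_projM.
End PSL2ZTheory.

(* Main.v *)
(* Fix distinct a, c <> 1 in H1, permuted by inversion, and b <> 1 in H2.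
   Every word carries an interval with two labelled end points ("sides").
   Prepending a^-1 or c^-1 to a word not starting in H1 halves its interval and
   keeps one end point; prepending b or b^-1 carries end points over, at least
   one of them; every other letter collapses the interval to its midpoint. Each
   step in H1 halves the total squared length, so the squared lengths are
   summable, and the first end point f satisfies g f - f in l^2 for every g:
   this is the cocycle. By construction f is invariant under an element p of
   infinite order, so the cocycle vanishes on <p>. But f is close to 0 on the
   negative and to 1 on the positive powers of another element h, and
   translating along h makes the cocycle unbounded on <h>. For PSL_2(Z), p is
   parabolic and h is hyperbolic. *)
Require Import Defs.
From HB Require Import structures.
From mathcomp Require Import all_boot all_order all_algebra all_fingroup.
From mathcomp Require Import boolp classical_sets functions cardinality.
From mathcomp Require Import finmap complex fsbigop reals ereal esum zify lra.

Set Implicit Arguments.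
Unset Strict Implicit.
Unset Printing Implicit Defensive.

Import Order.TTheory GRing.Theory Num.Theory.

Local Open Scope classical_set_scope.

Lemma sqr_dist_ge (R : realFieldType) (u v : R) :
  (v <= 1 / 4 -> 3 / 4 <= u -> 1 / 4 <= (v - u) ^+ 2)%R.
Proof. by move=> hu hv; nra. Qed.

(** * Square summability and formal coboundaries *)

Section SquareSums.
Variables (R : realType) (G : groupType).
Import Normc.
Local Open Scope ring_scope.
Local Open Scope complex_scope.
Implicit Types (f g : G -> R).

Definition l2 f := (fun x => (f x)%:C : R[i]) \in @square_summable R G.

Lemma normc_real (r : R) : normc r%:C = `|r|.
Proof. by rewrite /= expr0n addr0 sqrtr_sqr. Qed.

Lemma l2_le f g : (forall x, `|f x| <= `|g x|) -> l2 g -> l2 f.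
Proof.
move=> fg; rewrite /l2 !inE; apply: le_lt_trans; apply: le_esum => x _.
by rewrite lee_fin !normc_real lerXn2r ?nnegrE.
Qed.

Lemma l2_bound f C :
  (forall s : seq G, uniq s -> \sum_(x <- s) f x ^+ 2 <= C) -> l2 f.
Proof.
move=> fC; rewrite /l2 !inE; apply: (@le_lt_trans _ _ C%:E); last exact: ltry.
apply: ge_ereal_sup => _ [A [finA _] <-].
rewrite fsbig_finite // sumEFin lee_fin.
rewrite (eq_bigr (fun x => f x ^+ 2)) ?fC ?fset_uniq // => x _.
by rewrite normc_real real_normK ?num_real.
Qed.

Lemma l2B f g : l2 f -> l2 g -> l2 (fun x => f x - g x).
Proof.
move=> f2 g2; rewrite /l2.
rewrite (_ : (fun _ => _) = (fun x => (f x)%:C : R[i]) -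
  (fun x => (g x)%:C : R[i])).
  exact: rpredB.
by apply/funext => x; rewrite rmorphB.
Qed.

Lemma l2D f g : l2 f -> l2 g -> l2 (fun x => f x + g x).
Proof.
move=> f2 g2; rewrite /l2.
rewrite (_ : (fun _ => _) = (fun x => (f x)%:C : R[i]) +
  (fun x => (g x)%:C : R[i])).
  exact: rpredD.
by apply/funext => x; rewrite rmorphD.
Qed.

Lemma l2_translate a f : l2 f -> l2 (fun x => f (a * x)%g).
Proof.
by move=> f2; have := square_summable_translate a^-1 (Ell2 f2); rewrite invgK.
Qed.

Lemma sum_le_ell2_norm (f : ell2 R G) (s : seq G) : uniq s ->
  \sum_(x <- s) normc (f x) ^+ 2 <= ell2_norm f ^+ 2.
Proof.
move=> us; have := valP f; rewrite inE => foo.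
have le_s : ((\sum_(x <- s) normc (f x) ^+ 2)%:E <= sum_sqr f)%E.
  apply: esum_ge; exists [set` s]; first by split=> //; exact: finite_seq.
  by rewrite -fsbig_seq // sumEFin.
have sum0 : 0 <= \sum_(x <- s) normc (f x) ^+ 2.
  by apply: sumr_ge0 => x _; rewrite sqr_ge0.
(* [fine] would send [+oo] to 0, so finiteness must come first. *)
have ffin : sum_sqr f \is a fin_num.
  by rewrite ge0_fin_numE // (le_trans _ le_s).
by rewrite /ell2_norm sqr_sqrtr -lee_fin fineK // (le_trans _ le_s).
Qed.

(* [f] need not be square summable, so this cocycle need not be inner. *)
Section Coboundary.
Variable f : G -> R.
Hypothesis df2 : forall a, l2 (fun x => f (a * x)%g - f x).

Definition coboundary a : ell2 R G := Ell2 (df2 a^-1%g).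

Lemma coboundary_cocycle : cocycle coboundary.
Proof.
move=> a c; apply/val_inj/funext => x /=.
by rewrite -[RHS]rmorphD /= invgM mulgA addrA subrK.
Qed.

(** The cocycle vanishes at every [p ^- n], so the ball of radius 1 already has an infinite
    preimage. *)
Lemma coboundary_not_proper (p : G) :
  (forall x, f (p * x)%g = f x) -> injective (fun n => p ^+ n)%g ->
  ~ proper_cocycle coboundary.
Proof.
move=> fp pinj /(_ 1 ltr01) fin; apply: infinite_nat.
have fpn n x : f (p ^+ n * x)%g = f x.
  by elim: n => [|n IH]; rewrite ?mul1g // expgS -mulgA fp.
apply: sub_finite_set (finite_preimage (f := fun n => p ^- n)%g _ fin)
  => [n _ /=|].
  have -> : coboundary (p ^- n)%g = 0.
    by apply/val_inj/funext => x /=; rewrite invgK fpn subrr.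
  rewrite /ell2_norm /sum_sqr esum1 ?sqrtr0 // => x _.
  by rewrite normc0 expr0n.
by move=> m n _ _ /invg_inj /pinj.
Qed.

(** At each of the [N] points [h, ..., h ^+ N], the value of the cocycle at [h ^+ N.+1] compares [f]
    on a negative and on a positive power, so the squared norm is at least [N / 4]. *)
Lemma coboundary_not_bounded (h : G) :
  injective (fun n => h ^+ n)%g ->
  (forall n, f (h ^- n.+1)%g <= 1 / 4) ->
  (forall n, 3 / 4 <= f (h ^+ n.+1)%g) ->
  ~ bounded_cocycle coboundary.
Proof.
move=> hinj fneg fpos; rewrite /bounded_cocycle.
set S := [set _ | _ in _]; move=> Soo.
have S0 : (0 <= ereal_sup S)%E.
  apply: le_trans (_ : (ell2_norm (coboundary 1%g))%:E <= _)%E.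
    by rewrite lee_fin sqrtr_ge0.
  by apply: ereal_sup_ubound; exists 1%g.
have Sfin : ereal_sup S \is a fin_num by rewrite ge0_fin_numE.
set C := fine (ereal_sup S).
have C0 : 0 <= C by rewrite fine_ge0.
pose N := (Num.bound (4 * C ^+ 2)).
have NC : 4 * C ^+ 2 < N%:R.
  by have := archi_boundP (_ : 0 <= 4 * C ^+ 2); apply; rewrite mulr_ge0 ?sqr_ge0.
have leC : ell2_norm (coboundary (h ^+ N.+1)%g) <= C.
  by rewrite -lee_fin fineK //; apply: ereal_sup_ubound; exists (h ^+ N.+1)%g.
pose s := [seq (h ^+ i.+1)%g | i <- iota 0 N].
have us : uniq s by rewrite map_inj_uniq ?iota_uniq // => i j /hinj [].
have := sum_le_ell2_norm (coboundary (h ^+ N.+1)%g) us.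
apply/negP; rewrite -ltNge; apply: (@le_lt_trans _ _ (C ^+ 2)).
  by rewrite lerXn2r ?nnegrE // ?sqrtr_ge0.
apply: (@lt_le_trans _ _ (\sum_(x <- s) (1 / 4))).
  rewrite big_const_seq count_predT size_map size_iota iter_addr_0 -mulr_natr; lra.
rewrite !big_map big_seq [leRHS]big_seq; apply: ler_sum => i.
rewrite mem_iota => /andP[_ iN].
rewrite normc_real real_normK ?num_real //.
(* As [i < N], the exponent [N - i] is at least 1, which avoids the unit element. *)
have -> : (h ^- N.+1 * h ^+ i.+1 = h ^- (N - i).-1.+1)%g.
  rewrite prednK ?subn_gt0 //.
  by rewrite -[in X in (h ^- X * _)%g](subnK (ltnW iN : i <= N)%N)
    -addnS addnC expgnDr invgM mulgVK.
by apply: sqr_dist_ge; [exact: fneg|exact: fpos].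
Qed.
End Coboundary.
End SquareSums.

(** The list [t] may have repetitions: each element of [s] in the support of [f] uses up one
    occurrence of itself in [t]. *)
Lemma ler_sum_support (R : numDomainType) (T : eqType) (f : T -> R)
    (s t : seq T) :
  (forall x, 0 <= f x)%R -> uniq s ->
  (forall x, x \in s -> f x != 0%R -> x \in t) ->
  (\sum_(x <- s) f x <= \sum_(x <- t) f x)%R.
Proof.
move=> f0; elim: s t => [|x s IH] t; first by rewrite big_nil sumr_ge0.
move=> /= /andP[xs us] st; rewrite big_cons.
have [fx|fx] := eqVneq (f x) 0%R.
  by rewrite fx add0r IH // => y ys; apply: st; rewrite inE ys orbT.
have xt := st x (mem_head _ _) fx.
rewrite (perm_big _ (perm_to_rem xt)) /= big_cons lerD2l IH // => y ys fy.
have := st y; rewrite inE ys orbT => /(_ isT fy).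
rewrite (perm_mem (perm_to_rem xt)) inE => /orP[/eqP yx|//].
by rewrite -yx ys in xs.
Qed.

(** * Intervals attached to reduced words *)

Section Letters.
Variables H1 H2 : groupType.
Implicit Types w : seq (H1 + H2).

Definition isl (a : H1 + H2) := if a is inl _ then true else false.
Definition head_in i w := if w is a :: _ then isl a == i else true.

Lemma head_in_behead i a w : reduced (a :: w) -> isl a = i -> head_in (~~ i) w.
Proof.
case: w => // c w; rewrite /reduced /= => /andP[_ /andP[+ _]].
by case: a c => ? [] ? + <-.
Qed.
End Letters.

Lemma dist_mid (R : realFieldType) (p q : R) :
  (`|p - (p + q) / 2| <= `|q - p|)%R.
Proof.
rewrite (_ : p - _ = (q - p) * - 2^-1)%R; last by lra.
by rewrite normrM normrN ler_piMr // ger0_norm; lra.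
Qed.

Section Sides.
Variables (R : realType) (H1 H2 : groupType).
(* [gen] lists a and c; [sw] tells whether they are inverse to each other
   (true) or two involutions (false). *)
Variables (gen : bool -> H1) (b : H2) (sw : bool).
Hypothesis gen1 : forall s, gen s != 1%g.
Hypothesis gen_inj : injective gen.
Hypothesis genV : forall s, (gen s)^-1%g = gen (s (+) sw).
Hypothesis b1 : b != 1%g.

Local Notation letter := (H1 + H2)%type.
Local Notation G := (free_product H1 H2).
Implicit Types (s : bool) (t u v w : seq letter) (x : G).
Local Open Scope ring_scope.

Let bgen s : H2 := if s then b^-1%g else b.

(** The shift by [sw] matches [genV]: prepending [gen s] moves the end point labelled [s] to the
    label [s (+) sw], and prepending its inverse moves it back. Likewise [bgen s] moves the label
    [~~ s] to [s]. A label that receives no end point gets the midpoint. *)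
Fixpoint side w s : R :=
  match w with
  | [::] => s%:R
  | inl h :: w' => if h == gen (s (+) sw) then side w' (s (+) sw)
                   else (side w' false + side w' true) / 2
  | inr k :: w' => if k == bgen s then side w' (~~ s)
                   else (side w' false + side w' true) / 2
  end.

Definition midpoint w : R := (side w false + side w true) / 2.
Definition gap w : R := side w true - side w false.

Lemma gen_eq s s' : (gen s == gen s') = (s == s').
Proof. by apply/eqP/eqP => [/gen_inj|->]. Qed.

Lemma mul_gen_eq1 s h : (gen s * h == 1)%g = (h == gen (s (+) sw)).
Proof. by rewrite -(inj_eq (mulgI (gen s)^-1%g)) mulKg mulg1 genV. Qed.

Lemma side_gen s w : reduced w ->
  side (push (inl (gen s)) w) (s (+) sw) = side w s.
Proof.
move=> rw; rewrite /push /= (negPf (gen1 s)) /=.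
have addbK' : s (+) sw (+) sw = s by rewrite -addbA addbb addbF.
case: w rw => [|[h|k] w] rw /=; rewrite /push /= ?(negPf (gen1 s)) /=
  ?addbK' ?eqxx //.
rewrite mul_gen_eq1; case: eqP => //= _; rewrite addbK'.
(* The merged letter [gen s * h] differs from [gen s] since [h != 1] in a reduced word; both sides
   are the same midpoint. *)
rewrite -{2}[gen s]mulg1 (inj_eq (mulgI _)).
by move: rw => /andP[/andP[/= /negPf -> _] _].
Qed.

Lemma side_b w : reduced w -> side (push (inr b) w) false = side w true.
Proof.
move=> rw; rewrite /push /= (negPf b1) /=.
case: w rw => [|[h|k] w] rw /=; rewrite /push /= ?(negPf b1) /= ?eqxx //.
rewrite -(inj_eq (mulgI b^-1%g)) mulKg mulg1; case: ifP => //= _.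
rewrite -{2}[b]mulg1 (inj_eq (mulgI _)).
by move: rw => /andP[/andP[/= /negPf -> _] _].
Qed.

(* Convexity: prefixing letters only averages and permutes the two sides. *)
Lemma side_cat t (m d : R) : (forall s, `|side t s - m| <= d) ->
  forall w s, `|side (w ++ t) s - m| <= d.
Proof.
move=> tmd; elim=> [|[h|k] w IH] s //=; case: ifP => // _;
  have := IH true; have := IH false; rewrite !ler_norml; lra.
Qed.

(** On reduced words, [strip1] and [strip2] pick the shortest element of the coset of a factor,
    hence are invariant under left multiplication by that factor. *)
Definition strip1 w := if w is inl _ :: w' then w' else w.
Definition strip2 w := if w is inr _ :: w' then w' else w.

(** If a letter is removed, the first end point is either this midpoint or the opposite end of the
    gap; otherwise the distance is half the gap. *)
Lemma side_strip1 w : `|side w false - midpoint (strip1 w)| <= `|gap w|.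
Proof.
case: w => [|[h|k] w]; rewrite /midpoint ?dist_mid //= /gap /=.
case: ifP => [/eqP ->|_]; last by rewrite subrr normr0.
by rewrite gen_eq; case: sw => /=; rewrite distrC.
Qed.

Lemma side_strip2 w : `|side w false - midpoint (strip2 w)| <= `|gap w|.
Proof.
case: w => [|[h|k] w]; rewrite /midpoint ?dist_mid //= /gap /=.
case: ifP => [/eqP ->|_]; last by rewrite subrr normr0.
case: ifP => _; last by rewrite distrC.
by rewrite [side w false + _]addrC dist_mid.
Qed.

Lemma strip1_push h w : reduced w -> strip1 (push (inl h) w) = strip1 w.
Proof.
move=> rw; rewrite /push /=; case: ifP => //= h1.
case: w rw => [|[h'|k] w] rw /=; rewrite /push /= ?h1 //=.
case: ifP => //= _; move: rw => /andP[_] /=.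
by case: w => [|[]].
Qed.

Lemma strip2_push k w : reduced w -> strip2 (push (inr k) w) = strip2 w.
Proof.
move=> rw; rewrite /push /=; case: ifP => //= h1.
case: w rw => [|[h|k'] w] rw /=; rewrite /push /= ?h1 //=.
case: ifP => //= _; move: rw => /andP[_] /=.
by case: w => [|[]].
Qed.

(** * Square summability of the gaps *)

Fixpoint gapped (i : bool) n : seq (seq letter) :=
  [::] :: if n is n'.+1 then
    if i then
      [seq a :: w | a <- [:: inl (gen false); inl (gen true)], w <- gapped false n']
    else [seq a :: w | a <- undup [:: inr b; inr b^-1%g], w <- gapped true n']
  else [::].

(** The bounds solve [x = 1 + y / 2] and [y = 1 + x]. Each of the two letters from [H1] divides a
    squared gap by 4. If [b] is an involution it preserves the squared gap, but [undup] leaves a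
    single letter; otherwise [b] and its inverse each divide it by 4. *)
Lemma sum_gapped i n :
  \sum_(w <- gapped i n) gap w ^+ 2 <= if i then 3 else 4.
Proof.
elim: n i => [|n IH] i /=.
  by rewrite big_seq1 /gap /= subr0 expr1n; case: i; lra.
rewrite big_cons {1}/gap /= subr0 expr1n; case: i.
  rewrite /= cats0 big_cat !big_map /=.
  have E s : \sum_(w <- gapped false n) gap (inl (gen s) :: w) ^+ 2 =
    (\sum_(w <- gapped false n) gap w ^+ 2) / 4.
    rewrite big_distrl /=; apply: eq_bigr => w _.
    rewrite /gap /= !gen_eq; case: s; case: sw => /=; lra.
  rewrite !E; have := IH false; lra.
have E k : k \in [:: b; b^-1%g] -> b != b^-1%g ->
    \sum_(w <- gapped true n) gap (inr k :: w) ^+ 2 =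
    (\sum_(w <- gapped true n) gap w ^+ 2) / 4.
  rewrite !inE => kb /negPf bV; rewrite big_distrl /=; apply: eq_bigr => w _.
  by rewrite /gap /=; case/orP: kb => /eqP ->;
    rewrite ?eqxx ?[b^-1%g == b]eq_sym ?bV; lra.
case: ifP => /=; rewrite cats0 ?big_cat !big_map /= inE.
  move=> /eqP [bV].
  apply: le_trans (_ : 1 + \sum_(w <- gapped true n) gap w ^+ 2 <= _).
    rewrite lerD2l; apply: ler_sum => w _.
    by rewrite /gap /= -bV eqxx -sqrrN opprB.
  have := IH true; lra.
move=> bV; have {}bV : b != b^-1%g by apply: contraFN bV => /eqP <-.
rewrite !E ?inE ?eqxx ?orbT //; have := IH true; lra.
Qed.

Lemma mem_gapped i n w : reduced w -> gap w != 0 -> (size w <= n)%N ->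
  head_in i w -> w \in gapped i n.
Proof.
elim: n i w => [|n IH] i [|a w] //= rw gw wn ai; rewrite inE /=.
have rw' := reduced_behead rw.
have ww : head_in (~~ i) w := head_in_behead rw (eqP ai).
(* Once the sides of a tail coincide, averaging and relabelling cannot separate them. *)
have {}gw0 : gap w != 0.
  apply: contra gw; rewrite /gap subr_eq0 => /eqP e; apply/eqP.
  have m : (side w false + side w true) / 2 = side w false by rewrite e; lra.
  by case: (a) => ? /=; rewrite m ?if_arg; do 2?[case: ifP => _];
    case: (sw) => /=; rewrite ?e subrr.
case: a {ai rw} (eqP ai) gw => [h|k] ai gw; rewrite -{}ai {i} in ww *.
  apply: (@allpairs_f letter _ _ cons [:: inl (gen false); inl (gen true)]
    (gapped false n)); last exact: (IH false _ rw' gw0 wn ww).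
  rewrite !inE; move: gw; rewrite /gap /=; case: ifP => [/eqP ->|_].
    by case: (sw); rewrite !eqxx ?orbT.
  by case: ifP => [/eqP ->|_]; rewrite ?subrr ?eqxx //; case: (sw); rewrite !eqxx ?orbT.
apply: (@allpairs_f letter _ _ cons (undup [:: inr b; inr b^-1%g])
  (gapped true n)); last exact: (IH true _ rw' gw0 wn ww).
rewrite mem_undup !inE; move: gw; rewrite /gap /=; case: ifP => [/eqP ->|_].
  by rewrite !eqxx ?orbT.
by case: ifP => [/eqP ->|_]; rewrite ?subrr ?eqxx.
Qed.

Lemma l2_gap : l2 (fun x : G => gap (val x)).
Proof.
(* The constant is 3 + 4, from the words starting in either factor. *)
apply: (@l2_bound _ _ _ 7) => s us.
rewrite -(big_map val predT (fun w => gap w ^+ 2)).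
pose n := \max_(x <- s) size (val x).
apply: le_trans (_ : \sum_(w <- gapped true n ++ gapped false n) gap w ^+ 2 <= _).
  apply: ler_sum_support => [w||_ /mapP[x xs ->] gx]; first exact: sqr_ge0.
    by rewrite map_inj_uniq //; exact: val_inj.
  have wn : (size (val x) <= n)%N by apply: leq_bigmax_seq.
  have {}gx : gap (val x) != 0 by apply: contra gx => /eqP ->; rewrite expr0n.
  rewrite mem_cat; apply/orP.
  have [i hi] : exists i, head_in i (val x).
    by case: (val x) => [|a w]; [exists true|exists (isl a) => /=].
  by case: i hi => hi; [left|right]; apply: mem_gapped hi; rewrite ?(valP x).
rewrite big_cat /=; have := sum_gapped true n; have := sum_gapped false n; lra.
Qed.

(** * Square summability of the translation differences *)

Lemma l2_push a (f : seq letter -> R) :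
  l2 (fun x : G => f (val x)) -> l2 (fun x : G => f (push a (val x))).
Proof.
pose l : G := FreeProduct (reduced_push a (isT : reduced [::])).
move=> /(l2_translate l); congr (l2 _); apply/funext => x.
by congr (f _); rewrite [LHS]/= -push_mul ?(valP x).
Qed.

(** The midpoint of the stripped word is unchanged by the letter [a], so it cancels between the
    errors at [push a w] and at [w]; the error is dominated by the gap. *)
Lemma l2_side_push a :
  l2 (fun x : G => side (push a (val x)) false - side (val x) false).
Proof.
pose strip := if isl a then strip1 else strip2.
have side_strip w : `|side w false - midpoint (strip w)| <= `|gap w|.
  by rewrite /strip; case: ifP => _; [exact: side_strip1|exact: side_strip2].
have strip_push (x : G) : strip (push a (val x)) = strip (val x).
  by rewrite /strip; case: (a) => ?;
    [apply: strip1_push|apply: strip2_push]; exact: valP.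
have d2 : l2 (fun x : G => side (val x) false - midpoint (strip (val x))).
  by apply: l2_le l2_gap => x.
have := l2B (@l2_push a (fun w => side w false - midpoint (strip w)) d2) d2.
congr (l2 _); apply/funext => x.
rewrite strip_push; lra.
Qed.

Lemma l2_side_translate (a : G) :
  l2 (fun x : G => side (val (a * x)%g) false - side (val x) false).
Proof.
case: a => w rw; elim: w rw => [|a w IH] rw.
  apply: (@l2_bound _ _ _ 0) => s _; rewrite big1 // => x _.
  by rewrite /= subrr expr0n.
have := l2D (l2_translate (FreeProduct (reduced_behead rw)) (l2_side_push a))
            (IH (reduced_behead rw)).
by congr (l2 _); apply/funext => x; rewrite addrA subrK.
Qed.

(** * The elements [p] and [h] of infinite order *)

Lemma side_bgen s w : reduced w ->
  side (push (inr (bgen s)) w) s = side w (~~ s).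
Proof.
case: s => rw; rewrite /bgen; last exact: side_b.
rewrite -side_b ?reduced_push // (@push_push _ _ _ _ (inr 1%g)) //=.
  by rewrite push1 //= eqxx.
by rewrite mulgV.
Qed.

(* [inr b :: turn] is the word of the element p above. *)
Definition turn : seq letter :=
  [:: inl (gen (~~ sw)); inr (bgen (~~ sw)); inl (gen false)].

Lemma bgen1 s : bgen s != 1%g.
Proof. by rewrite /bgen; case: s; rewrite ?invg_eq1. Qed.

(** As the letters are stripped from the left, the tracked label runs through [false], [true],
    [~~ sw], [sw], [false]. *)
Lemma side_turn w : reduced w ->
  side (word_mul (inr b :: turn) w) false = side w false.
Proof.
move=> rw; rewrite /word_mul /= side_b ?reduced_push //.
have {1}-> : true = (~~ sw) (+) sw by case: (sw).
rewrite side_gen ?reduced_push // side_bgen ?reduced_push // negbK.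
by rewrite -[X in side _ X]addFb side_gen.
Qed.

(** The two letters of [turn] from [H1] each halve the interval of [t], with [side t false] kept as
    an end point; further prefixes stay inside the result. *)
Lemma side_cat_turn w t :
  `|side (w ++ turn ++ t) false - side t false| <= `|gap t| / 4.
Proof.
apply: side_cat => s; rewrite /turn /gap /= !gen_eq.
have := ler_norm (side t true - side t false).
have := ler_norm (- (side t true - side t false)); rewrite normrN.
move: `|_| => d; rewrite ler_norml.
case: sw s => -[] /=; rewrite ?eqxx /=; do 2?[case: ifP => _]; lra.
Qed.

(** Being reduced concerns adjacent letters only, and no adjacent pair straddles the nonempty
    [v]. *)
Lemma reduced_cat3 u v w : v != [::] ->
  reduced (u ++ v) -> reduced (v ++ w) -> reduced (u ++ v ++ w).
Proof.
case: v u => // c v [|d u] // _; rewrite /reduced !all_cat /=.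
rewrite !cat_path /= cat_path.
move=> /andP[/andP[-> _] /and3P[-> -> _]] /andP[/andP[-> ->] /andP[-> ->]].
by [].
Qed.

Lemma word_mul_cat u v : reduced (u ++ v) -> word_mul u v = u ++ v.
Proof.
elim: u => //= a u IH ruv; rewrite IH ?push_reduced //.
exact: reduced_behead ruv.
Qed.

Lemma val_expg x n : val x != [::] -> reduced (val x ++ val x) ->
  val (x ^+ n)%g = flatten (nseq n (val x)).
Proof.
move=> x0 rxx; have rfl m : reduced (flatten (nseq m.+1 (val x))).
  elim: m => [|m IH]; first by rewrite /= cats0 (valP x).
  by move: IH => /=; exact: reduced_cat3.
elim: n => // n IH; rewrite expgS [LHS]/= IH word_mul_cat //.
exact: rfl.
Qed.

Lemma expg_inj x : val x != [::] -> reduced (val x ++ val x) ->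
  injective (fun n => x ^+ n)%g.
Proof.
move=> x0 rxx m n /(congr1 (size \o val)) /=; rewrite !val_expg //.
rewrite !size_flatten /shape !map_nseq !sumn_nseq => /eqP.
by rewrite eqn_pmul2l ?lt0n ?size_eq0 // => /eqP.
Qed.

Lemma word_inv_cat u v : word_inv (u ++ v) = word_inv v ++ word_inv u.
Proof. by rewrite /word_inv map_cat rev_cat. Qed.

Lemma exists_unbounded_nonproper_cocycle : exists c : G -> ell2 R G,
  [/\ cocycle c, ~ proper_cocycle c & ~ bounded_cocycle c].
Proof.
exists (coboundary l2_side_translate).
split; first exact: coboundary_cocycle.
  have rp : reduced ((inr b :: turn) ++ (inr b :: turn)).
    by rewrite /reduced /= b1 !gen1 !bgen1.
  have rp1 : reduced (inr b :: turn) by rewrite /reduced /= b1 !gen1 !bgen1.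
  pose p : G := FreeProduct rp1.
  apply: (@coboundary_not_proper _ _ _ _ p); last exact: expg_inj.
  by move=> x; apply: side_turn; exact: valP.
(* Positive powers of [h] end in [turn] followed by [b], negative ones in [turn], so [side_cat_turn]
   compares them with [side [:: inr b] false = 1] and [side [::] false = 0]. *)
pose w := word_inv turn ++ inr b :: turn ++ [:: inr b].
have rw1 : reduced w by rewrite /reduced /= !invg_eq1 b1 !gen1 !bgen1.
have rw : reduced (w ++ w) by rewrite /reduced /= !invg_eq1 b1 !gen1 !bgen1.
pose h : G := FreeProduct rw1.
apply: (@coboundary_not_bounded _ _ _ _ h) => [|n|n]; first exact: expg_inj.
  rewrite -[val _]/(word_inv (val (h ^+ n.+1)%g)) val_expg //.
  rewrite -[flatten _]/(w ++ flatten (nseq n w)) word_inv_cat word_inv_cat.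
  rewrite word_invK catA -[turn]cats0.
  have := side_cat_turn (word_inv (flatten (nseq n w)) ++
    word_inv (inr b :: turn ++ [:: inr b])) [::].
  rewrite /gap /= subr0 subr0 normr1 ler_norml => /andP[_]; lra.
rewrite val_expg // -(addn1 n) nseqD flatten_cat.
rewrite -[flatten (nseq 1 _)]/(w ++ [::]) cats0 /w.
have := side_cat_turn (flatten (nseq n w) ++ word_inv turn ++ [:: inr b])
  [:: inr b].
have : `|gap [:: inr b]| <= 1.
  by rewrite /gap /= eqxx ler_norml; case: ifP => _ /=; lra.
move=> g1; rewrite -!catA.
rewrite -[side [:: inr b] false]/(if b == b then 1 else _) eqxx ler_norml.
by move=> /andP[+ _]; lra.
Qed.

End Sides.

(** * Isomorphisms and transport of cocycles *)

Section Isomorphic.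
Implicit Types G H K : groupType.

Lemma multiplicative1 G H (f : {multiplicative G -> H}) : f 1%g = 1%g.
Proof. by apply: (mulgI (f 1%g)); rewrite -gmulfM !mulg1. Qed.

Lemma multiplicativeV G H (f : {multiplicative G -> H}) x :
  f x^-1%g = (f x)^-1%g.
Proof. by apply: (mulgI (f x)); rewrite -gmulfM !mulgV multiplicative1. Qed.

Lemma isomorphic_sym G H : isomorphic G H -> isomorphic H G.
Proof.
move=> [f [g fK gK]].
have gM := can2_gmulfM fK gK.
pose g' : {multiplicative H -> G} :=
  HB.pack g (isMultiplicative.Build H G g gM).
by exists g'; exists f.
Qed.

Lemma isomorphic_trans G H K :
  isomorphic G H -> isomorphic H K -> isomorphic G K.
Proof.
move=> [f fbij] [g gbij].
have gfM : {morph g \o f : x y / (x * y)%g} by move=> x y; rewrite /= !gmulfM.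
pose gf : {multiplicative G -> K} :=
  HB.pack (g \o f) (isMultiplicative.Build G K (g \o f) gfM).
by exists gf; exact: bij_comp.
Qed.

(** Uniqueness in the universal property identifies both composites of the swaps with the
    identity. *)
Lemma isomorphic_free_productC H K :
  isomorphic (free_product H K) (free_product K H).
Proof.
have [f [fl fr _]] := free_product_universal
  (@fp_inr K H : {multiplicative H -> _}) (@fp_inl K H : {multiplicative K -> _}).
have [g [gl gr _]] := free_product_universal
  (@fp_inr H K : {multiplicative K -> _}) (@fp_inl H K : {multiplicative H -> _}).
exists f; exists g => x.
  have [e [_ _ eu]] := free_product_universal
    (@fp_inl H K : {multiplicative H -> _}) (@fp_inr H K : {multiplicative K -> _}).
  rewrite -[LHS]/((g \o f) x) -[RHS]/(idfun x) !eu //= => y.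
    by rewrite fl gr.
  by rewrite fr gl.
have [e [_ _ eu]] := free_product_universal
  (@fp_inl K H : {multiplicative K -> _}) (@fp_inr K H : {multiplicative H -> _}).
rewrite -[LHS]/((f \o g) x) -[RHS]/(idfun x) !eu //= => y.
  by rewrite gl fr.
by rewrite gr fl.
Qed.

(** An element whose square is not 1 is paired with its inverse. If all squares are 1, two distinct
    non-trivial elements serve; if there is only one, the group is cyclic of order 2. *)
Lemma nontrivial_neq_Z2 H : nontrivial H -> ~ isomorphic H 'Z_2 ->
  exists gen : bool -> H, exists sw : bool,
    [/\ forall s, gen s != 1%g, injective gen
      & forall s, (gen s)^-1%g = gen (s (+) sw)].
Proof.
move=> [a /eqP a1] notZ2.
have [[x x2]|allinv] := pselect (exists x : H, (x * x != 1)%g).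
  have x1 : x != 1%g by apply: contraNneq x2 => ->; rewrite mulg1.
  have xV : x != x^-1%g by apply: contraNneq x2 => {2}->; rewrite mulgV.
  exists (fun s => if s then x^-1%g else x), true; split.
  - by case; rewrite ?invg_eq1.
  - by case; case=> // e; case/eqP: xV.
  - by case; rewrite /= ?invgK.
have xV x : x^-1%g = x :> H.
  apply/(mulgI x); rewrite mulgV; apply/esym/eqP/negPn/negP => xx.
  by apply: allinv; exists x.
have [[c [ca c1]]|two] := pselect (exists c : H, c != a /\ c != 1%g).
  exists (fun s => if s then c else a), false; split.
  - by case.
  - by case; case=> // e; case/eqP: ca.
  - by move=> s; rewrite addbF xV.
case: notZ2.
have H2 x : x = 1%g \/ x = a.
  case: (eqVneq x 1%g) => [|x1]; [by left|right].
  by apply/eqP/negPn/negP => xa; apply: two; exists x.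
pose f (x : H) : 'Z_2 := if x == 1%g then 0%R else 1%R.
have fM : {morph f : x y / (x * y)%g}.
  have aa : (a * a = 1)%g by rewrite -{1}(xV a) mulVg.
  move=> x y; have [->|->] := H2 x; have [->|->] := H2 y;
    by rewrite /f ?mul1g ?mulg1 ?aa ?eqxx ?(negPf a1); apply/val_inj.
pose f' : {multiplicative H -> 'Z_2} :=
  HB.pack f (isMultiplicative.Build H 'Z_2 f fM).
exists f'; exists (fun z : 'Z_2 => if z == 0%R then 1%g else a) => [x|z] /=.
  by rewrite /f; have [->|->] := H2 x; rewrite ?eqxx ?(negPf a1).
by rewrite /f; case: z => -[|[|//]] i; rewrite ?eqxx ?(negPf a1);
  apply/val_inj; rewrite //= (negPf a1).
Qed.
End Isomorphic.

(** The isomorphism is composed both with the cocycle and with its values; reindexing the sum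
    preserves norms. *)
Lemma cocycle_transport (R : realType) (G G' : groupType) : isomorphic G' G ->
  (exists c : G -> ell2 R G,
     [/\ cocycle c, ~ proper_cocycle c & ~ bounded_cocycle c]) ->
  exists c : G' -> ell2 R G',
     [/\ cocycle c, ~ proper_cocycle c & ~ bounded_cocycle c].
Proof.
move=> [f fbij] [c [cM cproper cbounded]]; have [g fK gK] := fbij.
have sumf (u : ell2 R G) : sum_sqr (fun x => u (f x)) = sum_sqr u.
  rewrite /sum_sqr [RHS](reindex_esum [set: G'] _ f) //.
  split=> [//|x y _ _ /(can_inj fK) //|y _].
  by exists (g y).
have uf2 (u : ell2 R G) : (fun x => u (f x)) \in @square_summable R G'.
  by have := valP u; rewrite !inE sumf.
pose c' x := Ell2 (uf2 (c (f x))).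
have normc' x : ell2_norm (c' x) = ell2_norm (c (f x)).
  by rewrite /ell2_norm sumf.
exists c'; split.
- move=> x y; apply/val_inj/funext => z /=.
  rewrite gmulfM cM -[RHS]/(c (f y) (f (x^-1 * z)%g) + c (f x) (f z))%R.
  by rewrite gmulfM multiplicativeV.
- move=> c'proper; apply: cproper => C C0.
  apply: sub_finite_set (finite_image f (c'proper C C0)) => y /= yC.
  by exists (g y); rewrite ?gK //= normc' gK.
- move=> c'bounded; apply: cbounded; move: c'bounded; rewrite /bounded_cocycle.
  congr (ereal_sup _ < +oo)%E; apply/seteqP; split=> _ [x _ <-].
    by exists (f x); rewrite ?normc'.
  by exists (g x); rewrite ?normc' ?gK.
Qed.

(** * The modular group *)

Section ModularGroup.
Local Open Scope ring_scope.
Implicit Types (a b c d p q r s : int) (M A B : SL2Z).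

Definition mat2 a b c d : 'M[int]_2 :=
  \matrix_(i < 2, j < 2)
    if i == ord0 then if j == ord0 then a else b
    else if j == ord0 then c else d.

Lemma mat2_entries (M : 'M[int]_2) :
  M = mat2 (M ord0 ord0) (M ord0 ord_max) (M ord_max ord0) (M ord_max ord_max).
Proof.
apply/matrixP => i j; rewrite mxE.
by case: i j => -[|[|//]] i [] [|[|//]] j /=; congr (M _ _); apply/val_inj.
Qed.

Lemma mat2M a b c d p q r s :
  mat2 a b c d *m mat2 p q r s =
  mat2 (a * p + b * r) (a * q + b * s) (c * p + d * r) (c * q + d * s).
Proof.
apply/matrixP => i j; rewrite !mxE !big_ord_recl big_ord0 !mxE /= addr0.
by case: ifP => _; case: ifP => _.
Qed.

Lemma det_mat2 a b c d : \det (mat2 a b c d) = a * d - b * c.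
Proof.
rewrite (expand_det_row _ ord0) !big_ord_recl big_ord0 addr0.
by rewrite /cofactor !det_mx11 !mxE /= mul1r mulN1r mulrN.
Qed.

Lemma mat2_1 : 1%:M = mat2 1 0 0 1.
Proof. by rewrite [LHS]mat2_entries !mxE. Qed.

Lemma mat2N a b c d : - mat2 a b c d = mat2 (- a) (- b) (- c) (- d).
Proof. by rewrite [LHS]mat2_entries !mxE. Qed.

Lemma mat2_inj a b c d p q r s :
  mat2 a b c d = mat2 p q r s -> [/\ a = p, b = q, c = r & d = s].
Proof.
move=> /matrixP e; have :=
  (e ord0 ord0, e ord0 ord_max, e ord_max ord0, e ord_max ord_max).
by rewrite !mxE /= => -[[[]]].
Qed.

Lemma det_rotS : \det (mat2 0 (-1) 1 0) == 1. Proof. by rewrite det_mat2. Qed.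
Lemma det_rotU : \det (mat2 0 1 (-1) (-1)) == 1. Proof. by rewrite det_mat2. Qed.
Lemma det_shear a : \det (mat2 1 a 0 1) == 1.
Proof. by rewrite det_mat2 mulr1 mulr0 subr0. Qed.

(** [rotS] squares to -1, whereas [rotU], of trace -1 and determinant 1, has cube 1 already in
    SL_2(Z). *)
Definition rotS := MkSL2Z det_rotS.
Definition rotU := MkSL2Z det_rotU.
Definition shear a := MkSL2Z (det_shear a).

Lemma zmod_morphism n (G : groupType) (g : G) : (1 < n)%N -> (g ^+ n = 1)%g ->
  {morph (fun x : 'Z_n => g ^+ (x : nat))%g : x y / (x * y)%g}.
Proof.
move=> n1 gn x y /=; rewrite -expgnDr.
have gm : (g ^+ (Zp_trunc n).+2 = 1)%g by rewrite Zp_cast.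
by rewrite [in RHS](divn_eq (x + y) (Zp_trunc n).+2) expgnDr
  mulnC expgM gm expg1n mul1g.
Qed.

Definition same_sign p q := ((0 <= p) && (0 <= q)) || ((p <= 0) && (q <= 0)).

(** Signs of entries make sense only in [SL2Z], where this lift is multiplicative merely up to sign,
    as [rotS] has order 4. *)
Definition lift_letter (x : 'Z_2 + 'Z_3) : SL2Z :=
  match x with inl h => rotS ^+ (h : nat) | inr k => rotU ^+ (k : nat) end%g.
Definition lift_word (w : seq ('Z_2 + 'Z_3)) : SL2Z :=
  foldr (fun x M => lift_letter x * M)%g 1%g w.

(* Ping-pong: [rotS] exchanges the condition that both columns have entries of
   equal sign with the condition that both have entries of opposite sign,
   whereas [rotU] and its square lead from the former to the latter and
   increase the norm. *)
Lemma lift_word_signs w : reduced w ->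
  exists a b c d, [/\ lift_word w = mat2 a b c d :> 'M_2, a * d - b * c = 1,
    head_in true w -> same_sign a c && same_sign b d,
    head_in false w -> same_sign a (- c) && same_sign b (- d) &
    (2 + count (fun x => ~~ isl x) w <= `|a| + `|b| + `|c| + `|d|)%N].
Proof.
elim: w => [_|x w IH rxw].
  by exists 1, 0, 0, 1; split=> //=; rewrite -mat2_1.
have [a [b [c [d [e det g0 g1 norm]]]]] := IH (reduced_behead rxw).
have x1 : ~~ letter_is1 x by move: rxw; rewrite /reduced /= => /andP[/andP[]].
have hw := head_in_behead rxw erefl.
have -> : lift_word (x :: w) = SL2Z_mx (lift_letter x) *m lift_word w :> 'M_2 by [].
rewrite e.
case: x {rxw} x1 hw => [h|k] x1 hw.
  have -> : lift_letter (inl h) = rotS.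
    by move: x1 {hw}; case: h => -[|[|//]].
  rewrite -[SL2Z_mx rotS]/(mat2 0 (-1) 1 0). rewrite mat2M.
  exists (- c), (- d), a, b; split=> //.
  - by congr (mat2 _ _ _ _); lia.
  - lia.
  - by move=> _; move: (g1 hw); rewrite /same_sign; lia.
  - by move: norm => /=; lia.
have {hw g0 g1} := g0 hw.
have [->|->] : lift_letter (inr k) = rotU \/ lift_letter (inr k) = (rotU * rotU)%g.
  by move: x1; case: k => -[|[|[|//]]] //= ? _; [left|right].
  rewrite -[SL2Z_mx rotU]/(mat2 0 1 (-1) (-1)) mat2M.
  move=> H; exists c, d, (- a - c), (- b - d); split=> //.
  - by congr (mat2 _ _ _ _); lia.
  - lia.
  - move: H; rewrite /same_sign; lia.
  (* The norm grows by [|c| + |d|], which is positive since the determinant is 1. *)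
  have nz : (c != 0) || (d != 0).
    rewrite -negb_and; apply: contra_eqN det => /andP[/eqP -> /eqP ->].
    by rewrite !mulr0.
  - by move: norm H => /=; rewrite /same_sign; lia.
have -> : (rotU * rotU)%g = SL2Z_mx rotU *m SL2Z_mx rotU :> 'M_2 by [].
rewrite -[SL2Z_mx rotU]/(mat2 0 1 (-1) (-1)) !mat2M.
move=> H; exists (- a - c), (- b - d), a, b; split=> //.
- by congr (mat2 _ _ _ _); lia.
- lia.
- move: H; rewrite /same_sign; lia.
have nz : (a != 0) || (b != 0).
  rewrite -negb_and; apply: contra_eqN det => /andP[/eqP -> /eqP ->].
  by rewrite !mul0r.
by move: norm H => /=; rewrite /same_sign; lia.
Qed.

(** A matrix of norm 2 leaves no letter from ['Z_3]; the word is then empty or a single letter,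
    whose lift [rotS] is not diagonal. *)
Lemma lift_word_eq_pm1 (x : free_product 'Z_2 'Z_3) :
  SL2Z_pm (lift_word (val x)) 1%g -> x = 1%g.
Proof.
case: x => w rw /= pm; apply/val_inj => /=.
have [a [b [c [d [e det _ _ norm]]]]] := lift_word_signs rw.
have {pm} [b0 c0 ad] : [/\ b = 0, c = 0 & (`|a| + `|d| = 2)%N].
  by case/orP: pm => /eqP /(congr1 SL2Z_mx);
    rewrite e /= mat2_1 ?mat2N => /mat2_inj[-> -> -> ->].
have {norm} : count (fun x => ~~ isl x) w == 0%N.
  by move: norm; rewrite b0 c0 !addn0 ad; case: count.
rewrite -leqn0 leqNgt -has_count => /hasPn alll.
case: w rw e alll => [//|[h|k] [|y w]] rw e alll.
- have h1 : rotS = lift_letter (inl h).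
    by move: rw; case: (h) => -[|[|//]].
  move: e; rewrite /lift_word /= mulmx1 -[SL2Z_mx _]/(SL2Z_mx (lift_letter (inl h))) -h1.
  by move=> /mat2_inj[_ b1 _ _]; move: b1; rewrite b0.
- have := alll y; rewrite !inE eqxx orbT => /(_ isT).
  by case: y rw {e alll} => // y; rewrite /reduced /= andbF.
- by have := alll (inr k) (mem_head _ _).
- by have := alll (inr k) (mem_head _ _).
Qed.

Lemma PSL2Z_proj_exp M n : PSL2Z_proj (M ^+ n)%g = (PSL2Z_proj M ^+ n)%g.
Proof.
elim: n => // n IH; rewrite !expgS -IH; exact: PSL2Z_projM.
Qed.

Lemma rotS_order : (PSL2Z_proj rotS ^+ 2 = 1)%g.
Proof.
rewrite -PSL2Z_proj_exp; apply/eqP; rewrite PSL2Z_projP; apply/orP; right.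
by apply/eqP/val_inj; rewrite expgS expg1 /= mat2M mat2_1 mat2N.
Qed.

Lemma rotU_order : (PSL2Z_proj rotU ^+ 3 = 1)%g.
Proof.
rewrite -PSL2Z_proj_exp (_ : rotU ^+ 3 = 1)%g //.
by apply/val_inj; rewrite 2!expgS expg1 /= !mat2M mat2_1.
Qed.

(** * Generation of SL_2(Z) by [rotS] and [rotU] *)

Section Generation.
Variable P : SL2Z -> Prop.
Hypothesis PM : forall A B, P A -> P B -> P (A * B)%g.
Hypothesis PV : forall A, P A -> P A^-1%g.
Hypothesis PN : forall A, P A -> P (SL2Z_opp A).
Hypotheses (PS : P rotS) (PU : P rotU).

Lemma P_shear a : P (shear a).
Proof.
have P1 : P (shear 1).
  rewrite (_ : shear 1 = rotS * rotU)%g; first exact: PM.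
  by apply/val_inj; rewrite /= mat2M.
have sD r s : shear (r + s) = (shear r * shear s)%g.
  apply/val_inj; rewrite /= mat2M; congr mat2; lia.
elim/int_rect: a => [|n IH|n IH].
- rewrite (_ : shear 0 = shear 1 * (shear 1)^-1)%g.
    by apply: PM => //; exact: PV.
  by rewrite mulgV; apply/val_inj; rewrite /= mat2_1.
- by rewrite intS sD; exact: PM.
rewrite (_ : shear _ = (shear 1)^-1 * shear (- n%:Z))%g.
  by apply: PM => //; exact: PV.
by apply: (mulgI (shear 1)); rewrite mulKVg -sD intS; congr shear; lia.
Qed.

(** Euclidean algorithm on the first column: [shear] reduces [a] modulo [c] and [rotS] moves the
    remainder to the lower left. When [c = 0] the matrix is a shear up to sign. *)
Lemma SL2Z_generated M : P M.
Proof.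
have [n] := ubnP (`|M ord_max ord0|)%N.
elim: n M => // n IH M Mn.
have : (M : 'M_2) = mat2 _ _ _ _ := mat2_entries M.
move: (M ord0 ord0) (M ord0 ord_max) (M ord_max ord0) (M ord_max ord_max) Mn
  => a b c d Mn e.
have det : a * d - b * c = 1 by rewrite -det_mat2 -e SL2Z_det.
have [c0|c0] := eqVneq c 0.
  have [[a1 d1]|[a1 d1]] : (a = 1 /\ d = 1) \/ (a = -1 /\ d = -1).
    have ad : a * d = 1 by move: det; rewrite c0 mulr0 subr0.
    have : (`|a| * `|d| == 1)%N by rewrite -abszM ad.
    rewrite muln_eq1 => /andP[/eqP a1 /eqP d1].
    have [a1'|a1'] : a = 1 \/ a = -1 by lia.
      by left; move: ad; rewrite a1' mul1r.
    by right; move: ad; rewrite a1' mulN1r => ad; split=> //; lia.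
  - rewrite (_ : M = shear b); first exact: P_shear.
    by apply/val_inj; rewrite /= e a1 c0 d1.
  rewrite (_ : M = SL2Z_opp (shear (- b))); first exact/PN/P_shear.
  by apply/val_inj; rewrite /= e a1 c0 d1 mat2N; congr mat2; lia.
pose A := (rotS * shear (- (a %/ c)%Z))%g.
have PA : P A by apply: PM => //; exact: P_shear.
rewrite -[M](mulKg A); apply: PM; first exact: PV.
apply: IH.
have -> : (A * M)%g = mat2 (- c) (- d) (a %% c)%Z (b - (a %/ c)%Z * d) :> 'M_2.
  rewrite /= e !mat2M; congr mat2; rewrite ?/modz; lia.
rewrite mxE /=; have := ltz_mod a c0; have := modz_ge0 a c0; lia.
Qed.
End Generation.

(** The universal property gives a map from the free product; the Euclidean algorithm makes it
    surjective and ping-pong makes it injective. *)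
Lemma PSL2Z_isomorphic : isomorphic PSL2Z (free_product 'Z_2 'Z_3).
Proof.
apply: isomorphic_sym.
pose f1 (h : 'Z_2) := (PSL2Z_proj rotS ^+ (h : nat))%g.
pose f2 (k : 'Z_3) := (PSL2Z_proj rotU ^+ (k : nat))%g.
have f1M : {morph f1 : x y / (x * y)%g}.
  by apply: zmod_morphism => //; exact: rotS_order.
have f2M : {morph f2 : x y / (x * y)%g}.
  by apply: zmod_morphism => //; exact: rotU_order.
have [f [fl fr _]] := free_product_universal
  (HB.pack f1 (isMultiplicative.Build 'Z_2 PSL2Z f1 f1M) :
     {multiplicative 'Z_2 -> PSL2Z})
  (HB.pack f2 (isMultiplicative.Build 'Z_3 PSL2Z f2 f2M) :
     {multiplicative 'Z_3 -> PSL2Z}).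
exists f.
have f_lift x : f x = PSL2Z_proj (lift_word (val x)).
  case: x => w rw; elim: w rw => [|x w IH] rw.
    by rewrite -[RHS]/(1%g : PSL2Z) -(multiplicative1 f); congr (f _);
      apply/val_inj.
  pose l : free_product _ _ :=
    match x with inl h => fp_inl _ h | inr k => fp_inr _ k end.
  have lE : FreeProduct rw = (l * FreeProduct (reduced_behead rw))%g.
    apply/val_inj => /=.
    have -> : word_of l = push x [::] by rewrite /l; case: (x).
    by rewrite -push_mul ?(reduced_behead rw) // [RHS]push_reduced.
  rewrite [LHS](congr1 f lE) gmulfM IH.
  rewrite [RHS](PSL2Z_projM (lift_letter x) (lift_word w)); congr (_ * _)%g.
  by rewrite /l; case: (x) => ?; rewrite ?fl ?fr /= PSL2Z_proj_exp.
have fsurj M : exists x, f x = PSL2Z_proj M.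
  apply: (SL2Z_generated (P := fun M => exists x, f x = PSL2Z_proj M)).
  - by move=> A B [x xA] [y yB]; exists (x * y)%g;
      rewrite gmulfM xA yB PSL2Z_projM.
  - by move=> A [x xA]; exists x^-1%g; rewrite !multiplicativeV xA.
  - move=> A [x xA]; exists x; rewrite xA; apply/eqP; rewrite PSL2Z_projP.
    by apply/orP; right; rewrite SL2Z_oppK.
  - by exists (fp_inl _ (1%R : 'Z_2)); rewrite fl /= /f1 expg1.
  - by exists (fp_inr _ (1%R : 'Z_3)); rewrite fr /= /f2 expg1.
have finj : injective f.
  move=> x y fxy; apply: (mulgI x^-1%g); rewrite mulVg.
  apply/esym/lift_word_eq_pm1.
  by rewrite -PSL2Z_projP -f_lift gmulfM multiplicativeV fxy mulVg.
have fsurj' y : exists x, f x = y.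
  by rewrite -(PSL2Z_repr y); exact: fsurj.
have [g gK] := choice fsurj'.
exists g => // x; apply: finj; exact: gK.
Qed.
End ModularGroup.

Theorem corollary2p8 (R : realType) :
  (forall H1 H2 : groupType,
     countable [set: H1] -> countable [set: H2] ->
     nontrivial H1 -> nontrivial H2 ->
     ~ isomorphic H1 'Z_2 ->
     exists c : free_product H1 H2 -> ell2 R (free_product H1 H2),
       [/\ cocycle c, ~ proper_cocycle c & ~ bounded_cocycle c])
  /\ isomorphic PSL2Z (free_product 'Z_2 'Z_3)
  /\ (exists c : PSL2Z -> ell2 R PSL2Z,
       [/\ cocycle c, ~ proper_cocycle c & ~ bounded_cocycle c]).
Proof.
split.
  move=> H1 H2 _ _ nt1 [b /eqP b1] /(nontrivial_neq_Z2 nt1).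
  move=> [gen [sw [gen1 gen_inj genV]]].
  exact: exists_unbounded_nonproper_cocycle gen1 gen_inj genV b1.
split; first exact: PSL2Z_isomorphic.
(* The factors are exchanged because the first one must not be cyclic of order 2. *)
apply: (cocycle_transport (G := free_product 'Z_3 'Z_2)).
  exact: isomorphic_trans PSL2Z_isomorphic (isomorphic_free_productC _ _).
have nt3 : nontrivial 'Z_3 by exists (1%R : 'Z_3) => /eqP.
have n32 : ~ isomorphic 'Z_3 'Z_2 by move=> [f /bij_eq_card]; rewrite !card_ord.
have [gen [sw [gen1 gen_inj genV]]] := nontrivial_neq_Z2 nt3 n32.
exact: (exists_unbounded_nonproper_cocycle R gen1 gen_inj genV (b := 1%R : 'Z_2)).
Qed.
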